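(* Let $n\in\mathbb{N}$. Every isotone Boolean function $f:\{0,1\}^n\to\{0,1\}$ is a lattice induced threshold function.
   Context: $\{0,1\}^n$ is ordered componentwise with respect to $0\le 1$. A Boolean function $f:\{0,1\}^n\to\{0,1\}$ is isotone if for all $x,y\in\{0,1\}^n$, $x\le y$ implies $f(x)\le f(y)$. For a complete lattice $L$ with bottom element $0$, $w\in L$ and $x\in\{0,1\}$, define $w\cdot x\in L$ by $w\cdot 1=w$ and $w\cdot 0=0$ (the bottom of $L$). A function $f:\{0,1\}^n\to\{0,1\}$ is a lattice induced threshold function if there exist a complete lattice $L$ and elements $w_1,\ldots,w_n,t\in L$ such that for all $(x_1,\ldots,x_n)\in\{0,1\}^n$: $f(x_1,\ldots,x_n)=1$ if and only if $\bigvee_{i=1}^n (w_i\cdot x_i)\ge t$. *)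

(* Defs.v *)
From mathcomp Require Import all_boot all_order.
From mathcomp Require Import boolp classical_sets.

Set Implicit Arguments.
Unset Strict Implicit.
Unset Printing Implicit Defensive.

Local Open Scope order_scope.
Local Open Scope classical_set_scope.

(* The tuple alias n.-tupleprod carries the componentwise order (leEtprod),
   and bool is ordered by false <= true. *)
Notation boolvec n := (n.-tupleprod bool).

Definition isotone (n : nat) (f : boolvec n -> bool) : Prop :=
  forall x y : boolvec n, x <= y -> f x <= f y.

Definition complete_lattice (d : Order.disp_t) (L : tbLatticeType d) : Prop :=
  forall A : set L, supremums A !=set0 /\ infimums A !=set0.

Definition bscale (d : Order.disp_t) (L : tbLatticeType d) (w : L) (b : bool) :
    L :=
  if b then w else \bot.

Definition lattice_induced_threshold (n : nat) (f : boolvec n -> bool) : Prop :=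
  exists (d : Order.disp_t) (L : tbLatticeType d), complete_lattice L /\
    exists (w : 'I_n -> L) (t : L), forall x : boolvec n,
      f x = true <-> \join_(i < n) bscale (w i) (tnth x i) >= t.

(* Main.v *)
Require Import Defs.
From mathcomp Require Import all_boot all_order.
From mathcomp Require Import boolp.

(** The lattice can be taken to be a power set, and the weights then encode a
    conjunctive normal form of [f].  For an isotone [f], [f x] holds exactly
    when [x] lies below no point [y] with [f y = false]: if [x <= y], then
    isotonicity carries the value [false] from [y] down to [x], and conversely
    [y := x] is such a point as soon as [f x = false].  Now [x <= y] fails
    exactly when some coordinate [i] has [x_i = 1] and [y_i = 0].  So, in the
    lattice of all sets of Boolean vectors, let the weight of coordinate [i] be
    the set of the [y] with [y_i = 0], and let the threshold be the set of the
    [y] with [f y = false].  The join of the weights selected by [x] is the set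
    of the [y] that are not above [x], so it contains the threshold exactly
    when [f x] holds.  This lattice is finite, hence complete
    ([finite_complete_lattice]). *)

Import Order.DefaultSetSubsetOrder Order.TTheory.
Local Open Scope order_scope.

(** An arbitrary subset of a finite lattice has only finitely many elements, so
    the iterated join and meet over it are its supremum and infimum; this covers
    the empty subset too, thanks to the bottom and top elements. *)
Lemma finite_complete_lattice (d : Order.disp_t) (L : finTBLatticeType d) :
  complete_lattice L.
Proof.
move=> A; split.
- exists (\join_(x : L | `[< A x >]) x); split=> [x Ax | y ubA].
    by apply: joins_sup; apply/asboolP.
  by apply/joinsP => x /asboolP; apply: ubA.
- exists (\meet_(x : L | `[< A x >]) x); split=> [x Ax | y lbA].
    by apply: meets_inf; apply/asboolP.
  by apply/meetsP => x /asboolP; apply: lbA.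
Qed.

Lemma in_join_set (T I : finType) (F : I -> {set T}) (y : T) :
  (y \in \join_(i : I) F i) = [exists i, y \in F i].
Proof.
have in_join : {morph (fun A : {set T} => y \in A) : A B / A `|` B >-> A || B}.
  by move=> A B; rewrite inE.
by rewrite (big_morph _ in_join (in_set0 y)) big_orE.
Qed.

Lemma in_bscale_set (T : finType) (A : {set T}) (b : bool) (y : T) :
  (y \in bscale A b) = b && (y \in A).
Proof. by case: b; rewrite //= inE. Qed.

Lemma boolvec_not_le (n : nat) (x y : boolvec n) :
  (~~ (x <= y)) = [exists i, tnth x i && ~~ tnth y i].
Proof.
rewrite leEtprod negb_forall; apply: eq_existsb => i.
by case: (tnth x i); case: (tnth y i).
Qed.

Theorem theorem3p2 (n : nat) (f : boolvec n -> bool) :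
  isotone f -> lattice_induced_threshold f.
Proof.
move=> f_mono.
exists _, {set boolvec n}; split; first exact: finite_complete_lattice.
exists (fun i => [set y : boolvec n | ~~ tnth y i]), [set y : boolvec n | ~~ f y].
move=> x.
have join_weights y :
    (y \in \join_(i < n)
       bscale ([set z : boolvec n | ~~ tnth z i] : {set boolvec n})
              (tnth x i)) = ~~ (x <= y).
  rewrite in_join_set boolvec_not_le; apply: eq_existsb => i.
  by rewrite in_bscale_set inE.
split=> [fx | /subsetP thr_sub].
- apply/subsetP => y; rewrite join_weights inE; apply: contra => le_xy.
  by have := f_mono _ _ le_xy; rewrite fx; case: (f y).
- (* [x] itself is never in the join, so it cannot belong to the threshold. *)
  apply: contraT => nfx.
  by have := thr_sub x; rewrite join_weights inE nfx lexx => /(_ isT).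
Qed.
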